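(* Let $\varepsilon>0$. Then, for all sufficiently large $n$, we have $$R_n<(7+\sqrt{33}+\varepsilon)^n.$$
   Context: For an integer $n\ge 0$, let $\mathcal{Q}(n)=\{(x,y)\in\mathbb{Z}^2: 0\le x,\ 0\le y,\ x+y\le n\}$. Let $\mathcal{R}(n)$ be the set of all subsets $Y\subseteq\mathcal{Q}(n)$ such that: for any $(a,b),(c,d)\in Y$ with $\max(a,c)+\max(b,d)\le n+1$, we have $(\min(a,c),\min(b,d))\in Y$ and, additionally, $(\max(a,c),\max(b,d))\in Y$ as soon as $(\max(a,c),\max(b,d))\in\mathcal{Q}(n)$. Put $R_n=|\mathcal{R}(n)|$. *)

(* Defs.v *)
From mathcomp Require Import all_boot all_order all_algebra.
From mathcomp Require Import reals.

Set Implicit Arguments.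
Unset Strict Implicit.
Unset Printing Implicit Defensive.

(* The lattice points (x, y) with 0 <= x, 0 <= y and x + y <= n. Both
   coordinates of such a point are at most n, so the points are taken in
   'I_n.+1 * 'I_n.+1; Order.min and Order.max on 'I_n.+1 are those of nat. *)
Definition Q (n : nat) : {set 'I_n.+1 * 'I_n.+1} :=
  [set p : 'I_n.+1 * 'I_n.+1 | p.1 + p.2 <= n].

Definition pmin (n : nat) (p q : 'I_n.+1 * 'I_n.+1) : 'I_n.+1 * 'I_n.+1 :=
  (Order.min p.1 q.1, Order.min p.2 q.2).

Definition pmax (n : nat) (p q : 'I_n.+1 * 'I_n.+1) : 'I_n.+1 * 'I_n.+1 :=
  (Order.max p.1 q.1, Order.max p.2 q.2).

(* The bound n.+1 exceeds the bound n defining Q n by one: when the maximum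
   lies on x + y = n.+1, just outside Q n, the minimum must still be in Y. *)
Definition calR (n : nat) : {set {set 'I_n.+1 * 'I_n.+1}} :=
  [set Y : {set 'I_n.+1 * 'I_n.+1} | (Y \subset Q n) &&
    [forall p in Y, forall q in Y,
      ((pmax p q).1 + (pmax p q).2 <= n.+1) ==>
        (pmin p q \in Y) && ((pmax p q \in Q n) ==> (pmax p q \in Y))]].

Definition Rnum (n : nat) : nat := #|calR n|.

(* Main.v *)
(* Let a be the least x >= 1 such that (x, 0) is in Y.  Closure empties the
   rectangle 0 < x < a, y <= n + 1 - a, and there column 0 is an initial segment
   of column a to which the height n + 1 - a has been added.  The parts of Y
   above and to the right of the rectangle are smaller sets of the same kind,
   the right one containing its own corner, and they determine Y together with
   the length of the initial segment.  If there is no such a, row 0 holds at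
   most the origin.  Weigh Y by 2 ^ #(column 0) * t ^ (n + 1).  The total weight
   S of all Y, over all n >= -1, and the weight B of those containing the origin
   then satisfy S <= 1 + 3 t S + 4 t S B and B <= 2 t S + 4 t S B.  These have a
   finite solution as soon as 1 / t >= 7 + sqrt 32, and 1 / t = 127 / 10 lies
   between 7 + sqrt 32 and 7 + sqrt 33. *)
From HB Require Import structures.
Require Import Defs.
From mathcomp Require Import all_boot all_order all_algebra.
From mathcomp Require Import reals.
From mathcomp Require Import zify ring lra.

Import Order.TTheory GRing.Theory Num.Theory.

(* Triangles are indexed by their number of rows m = n + 1, so that the empty
   triangle is m = 0. *)
Definition tri_closed (m : nat) (Y : nat -> nat -> bool) : Prop :=
  (forall x y, Y x y -> (x + y < m)%N) /\
  (forall x y x' y', Y x y -> Y x' y' -> (maxn x x' + maxn y y' <= m)%N ->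
     Y (minn x x') (minn y y') /\
     ((maxn x x' + maxn y y' < m)%N -> Y (maxn x x') (maxn y y'))).

Lemma tri_closed_shift m a b Y : tri_closed (a + b + m) Y ->
  tri_closed m (fun x y => Y (x + a)%N (y + b)%N).
Proof.
move=> [sub cl]; split=> [x y /sub|x y x' y' Yp Yq le_m]; first by lia.
have [|min_in max_in] := cl _ _ _ _ Yp Yq; first by lia.
rewrite !(addn_minl _ _ a, addn_minl _ _ b, addn_maxl _ _ a, addn_maxl _ _ b).
split=> // lt_m.
by apply: max_in; lia.
Qed.

(* [Side k g h] glues [g] above and [h] to the right of an empty rectangle, and
   keeps the first [k] points of the column of [h] extended by its top; [Up o g]
   puts [g] above a row whose only possible point is the origin. *)
Inductive code := Leaf | Up of bool & code | Side of nat & code & code.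

Lemma code_eq_comparable : comparable code.
Proof.
by rewrite /comparable /decidable; decide equality; apply: eq_comparable.
Qed.

HB.instance Definition _ := hasDecEq.Build code (compareP code_eq_comparable).

Fixpoint dim (c : code) : nat :=
  match c with
  | Leaf => 0
  | Up _ g => (dim g).+1
  | Side _ g h => (dim g + dim h).+1
  end.

Fixpoint col0 (c : code) : nat :=
  match c with
  | Leaf => 0
  | Up o g => o + col0 g
  | Side k g _ => k + col0 g
  end.

Definition initial_seg (k : nat) (P : pred nat) : pred nat :=
  fun y => P y && (count P (iota 0 y) < k)%N.

Fixpoint pts (c : code) (x y : nat) : bool :=
  match c with
  | Leaf => false
  | Up o g => if y is y'.+1 then pts g x y' else (x == 0) && o
  | Side k g h =>
      if (x <= dim g)%N then
        if (y <= dim h)%N then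
          (x == 0) && initial_seg k (predU1 (dim h) (pts h 0)) y
        else pts g x (y - (dim h).+1)
      else pts h (x - (dim g).+1) y
  end.

(** [h] must contain its own corner, which is placed at the point (a, 0). Column 0 of [h] with the
    added height has [col0 h + 1] points, so [k] takes [col0 h + 2] values. *)
Definition sides (s : seq code) : seq code :=
  [seq Side k gh.1 gh.2
     | gh <- [seq (g, h) | g <- s, h <- [seq c <- s | pts c 0 0]],
       k <- iota 0 (col0 gh.2).+2].

(* Codes are enumerated by depth rather than by dimension, so that weighted sums
   over them obey a product recursion instead of a convolution. *)
Fixpoint codes (d : nat) : seq code :=
  if d is d'.+1 then
    let s := codes d' in
    Leaf :: map (Up true) s ++ map (Up false) s ++ sides s
  else [:: Leaf].

(** * Decomposition of closed sets into codes *)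

Lemma sub_in_count (P S : pred nat) (s : seq nat) :
  {in s, subpred S P} -> (count S s <= count P s)%N.
Proof.
move=> SP; rewrite (_ : count S s = count (predI P S) s).
  by apply: sub_count => y /andP[].
by apply: eq_in_count => y /SP; rewrite /=; case: (S y) => [->|] //; rewrite andbF.
Qed.

(** Up to [q], [P] and [S] agree below any point of [S], so its rank is the same in both; a point of
    [P] outside [S] lies above all of [S]. *)
Lemma initial_segP (P S : pred nat) (q : nat) :
    (forall y, (y <= q)%N -> S y -> P y) ->
    (forall y z, (y < z <= q)%N -> S z -> P y -> S y) ->
  forall y, (y <= q)%N -> initial_seg (count S (iota 0 q.+1)) P y = S y.
Proof.
move=> SP Sdown y le_yq; rewrite /initial_seg.
have -> : q.+1 = (y + (q - y).+1)%N by lia.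
rewrite iotaD count_cat add0n /=.
have [Sy | nSy] := boolP (S y).
  rewrite SP //=.
  suff -> : count P (iota 0 y) = count S (iota 0 y) by lia.
  apply: eq_in_count => z; rewrite mem_iota => ltz; apply/idP/idP.
    by apply: (Sdown z y) => //; lia.
  by apply: SP; lia.
have [Py | //] := boolP (P y); rewrite /=; apply/negbTE; rewrite -leqNgt.
have -> : count S (iota y.+1 (q - y)) = 0.
  apply/eqP; rewrite -leqn0 leqNgt -has_count; apply/hasPn => z.
  rewrite mem_iota => ltz; apply: contra nSy => Sz.
  by apply: (Sdown y z) => //; lia.
rewrite /= !addn0; apply: sub_in_count => z; rewrite mem_iota => ltz.
by apply: SP; lia.
Qed.

Lemma count_iota_shift (P : pred nat) a b m :
  count P (iota (a + b) m) = count (fun y => P (y + b)%N) (iota a m).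
Proof.
rewrite addnC iotaDl count_map; apply: eq_count => y /=.
by rewrite addnC.
Qed.

Lemma codes_complete d m Y : (m <= d)%N -> tri_closed m Y ->
  exists2 c, c \in codes d &
    [/\ dim c = m, col0 c = count (Y 0) (iota 0 m) & pts c =2 Y].
Proof.
elim: d m Y => [|d IH] m Y le_md clY.
  move: le_md clY; rewrite leqn0 => /eqP-> [sub _].
  exists Leaf; first by rewrite mem_head.
  by split=> // x y; apply/esym/negP => /sub.
case: m => [|m] in le_md clY *.
  case: clY => sub _; exists Leaf; first by rewrite mem_head.
  by split=> // x y; apply/esym/negP => /sub.
have [sub cl] := clY.
have [row0 | row0] := boolP (has (fun x => Y x 0) (iota 1 m)); last first.
  have [|g gin [dg cg pg]] := IH m (fun x y => Y (x + 0)%N (y + 1)%N) le_md.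
    by apply: tri_closed_shift.
  exists (Up (Y 0 0) g).
    rewrite inE !mem_cat; case: (Y 0 0); first by rewrite map_f ?orbT.
    by rewrite [X in _ || (_ || X)]orbC map_f ?orbT.
  split=> /=; first by rewrite dg.
    by rewrite cg (count_iota_shift (Y 0) 0 1).
  move=> x [|y]; last by rewrite pg addn0 addn1.
  case: eqP => [-> // | /eqP x0] /=; apply/esym; apply/negP => Yx0.
  move/hasPn: row0 => /(_ x); rewrite mem_iota Yx0 => /(_ _)/negP; apply=> //.
  by move/sub: Yx0; lia.
have exa : exists a, (0 < a)%N && Y a 0.
  by case/hasP: row0 => a; rewrite mem_iota => /andP[a0 _] Ya; exists a; rewrite a0.
case: (ex_minnP exa) => -[//|p] /andP[_ Yp] min_p.
have lt_pm := sub _ _ Yp.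
pose q := (m - p)%N.
have [||g gin [dg cg pg]] := IH p (fun x y => Y (x + 0)%N (y + q.+1)%N).
- by lia.
- by apply: tri_closed_shift; rewrite (_ : (0 + q.+1 + p)%N = m.+1) //; lia.
have [||h hin [dh ch ph]] := IH q (fun x y => Y (x + p.+1)%N (y + 0)%N).
- by lia.
- by apply: tri_closed_shift; rewrite (_ : (p.+1 + 0 + q)%N = m.+1) //; lia.
pose k := count (Y 0) (iota 0 q.+1).
(* With a = [p.+1], the maximum of (0, y) and (a, 0) is (a, y). It lies in the triangle for y < [q]
   and just outside for y = [q], hence the added height. *)
have YP y : (y <= q)%N -> Y 0 y -> predU1 q (pts h 0) y.
  move=> le_yq Y0; rewrite /= ph /= add0n addn0.
  case: eqP => //= /eqP ne_yq; have [|_] := cl _ _ _ _ Y0 Yp; first by lia.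
  by rewrite max0n maxn0; apply; lia.
(* The minimum of (0, z) and (a, y) is (0, y), which stays in [Y] even when the maximum (a, z) is
   just outside the triangle. *)
have Ydown y z : (y < z <= q)%N -> Y 0 z -> predU1 q (pts h 0) y -> Y 0 y.
  move=> /andP[lt_yz le_zq] Yz /=; rewrite ph /= add0n addn0.
  case: eqP => [|_ /= Yy]; first by lia.
  have [|] := cl _ _ _ _ Yz Yy; first by lia.
  by rewrite min0n (minn_idPr (ltnW lt_yz)).
exists (Side k g h).
  rewrite inE !mem_cat; apply/orP; right; apply/orP; right; apply/orP; right.
  apply/allpairsPdep; exists (g, h), k; split=> //.
    by apply/allpairsP; exists (g, h); rewrite mem_filter ph Yp hin.
  rewrite mem_iota /= ch add0n ltnS /k.
  rewrite -[q.+1]addn1 iotaD count_cat /= !addn0 -addn1 leq_add ?leq_b1 //.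
  apply: sub_in_count => y; rewrite mem_iota => lt_yq /YP.
  by rewrite /= ph /= => /(_ _)/orP[||//]; lia.
split; first by rewrite /= dg dh; lia.
  rewrite (_ : m.+1 = q.+1 + p) ?iotaD ?count_cat; last by lia.
  by rewrite (count_iota_shift (Y 0) 0 q.+1) -cg.
move=> x y; rewrite [LHS]/= dg dh.
have [le_xp | lt_px] := leqP x p; last first.
  by rewrite ph addn0 subnK.
have [le_yq | lt_qy] := leqP y q; last by rewrite pg addn0 subnK.
case: eqP => [-> | /eqP x0] /=; first by rewrite initial_segP.
(* A point (x, y) of the rectangle and (a, 0) have minimum (x, 0), against the minimality of a. *)
apply/esym/negP => Yxy.
have [|] := cl _ _ _ _ Yxy Yp; first by lia.
rewrite minn0 => Yx0 _.
by have := min_p (minn x p.+1); rewrite Yx0; lia.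
Qed.

(** * Weighted sums over codes *)

Local Open Scope ring_scope.

Section Weight.
Variables (R : realFieldType) (t : R).
Hypothesis t_ge0 : 0 <= t.

Definition weight (c : code) : R := 2%:R ^+ col0 c * t ^+ dim c.

Let S d : R := \sum_(c <- codes d) weight c.
Let B d : R := \sum_(c <- codes d | pts c 0 0) weight c.

Lemma weight_ge0 c : 0 <= weight c.
Proof. by rewrite mulr_ge0 ?exprn_ge0. Qed.

(** The geometric sum over [k] is below [2 ^ (col0 h + 2)], which restores the factor [2 ^ col0 h]
    in the weight of [h]: this is the purpose of weighing column 0. *)
Lemma sum_Side_le g h :
  \sum_(k <- iota 0 (col0 h).+2) weight (Side k g h)
    <= 4%:R * t * (weight g * weight h).
Proof.
have geom n : \sum_(k <- iota 0 n) 2%:R ^+ k <= 2%:R ^+ n :> R.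
  suff -> : \sum_(k <- iota 0 n) 2%:R ^+ k = 2%:R ^+ n - 1 :> R by lra.
  rewrite -[n]subn0 -/(index_iota 0 n) subn0.
  by rewrite subrX1 big_mkord (_ : 2%:R - 1 = 1 :> R) ?mul1r //; lra.
rewrite (eq_bigr (fun k => 2%:R ^+ k * (t * weight g * t ^+ dim h))); last first.
  by move=> k _; rewrite /weight /= exprS !exprD; ring.
rewrite -mulr_suml.
apply: le_trans (ler_wpM2r _ (geom _)) _.
  by rewrite !mulr_ge0 ?weight_ge0 ?exprn_ge0.
by rewrite /weight !exprS le_eqVlt; apply/orP; left; apply/eqP; ring.
Qed.

Lemma sum_sides_le d (P : pred code) :
  \sum_(c <- sides (codes d) | P c) weight c <= 4%:R * t * (S d * B d).
Proof.
rewrite big_mkcond !big_allpairs_dep /=.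
rewrite /S mulr_suml mulr_sumr; apply: ler_sum => g _.
rewrite big_filter /B !mulr_sumr; apply: ler_sum => h _.
apply: le_trans _ (sum_Side_le g h); apply: ler_sum => k _.
by case: ifP => // _; apply: weight_ge0.
Qed.

Lemma sum_Up (o : bool) d :
  \sum_(g <- codes d) weight (Up o g) = 2%:R ^+ o * t * S d.
Proof.
rewrite /S mulr_sumr; apply: eq_bigr => g _.
by rewrite /weight /= exprS exprD; ring.
Qed.

Lemma total_weight_step d : S d.+1 <= 1 + 3%:R * t * S d + 4%:R * t * (S d * B d).
Proof.
rewrite {1}/S /= big_cons !big_cat !big_map /= !sum_Up.
have := sum_sides_le d xpredT; rewrite /weight /= !expr0 expr1 mul1r.
by lra.
Qed.

Lemma origin_weight_step d : B d.+1 <= 2%:R * t * S d + 4%:R * t * (S d * B d).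
Proof.
rewrite {1}/B /= big_cons !big_cat !big_map /= sum_Up expr1 big_pred0_eq add0r.
by rewrite lerD2l; apply: sum_sides_le.
Qed.

End Weight.

Lemma total_weight_le (R : realFieldType) d :
  \sum_(c <- codes d) weight R (10%:R / 127%:R) c <= 93%:R / 50%:R :> R.
Proof.
set t : R := 10%:R / 127%:R.
have t_ge0 : 0 <= t by rewrite /t; lra.
have S_ge0 n : 0 <= \sum_(c <- codes n) weight R t c.
  by apply: sumr_ge0 => c _; apply: weight_ge0.
have B_ge0 n : 0 <= \sum_(c <- codes n | pts c 0 0) weight R t c.
  by apply: sumr_ge0 => c _; apply: weight_ge0.
(* The pair (93/50, 713/1000) is a supersolution of the two recursions at t = 10/127, so both bounds
   pass from each depth to the next. *)
suff [] : \sum_(c <- codes d) weight R t c <= 93%:R / 50%:R /\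
    \sum_(c <- codes d | pts c 0 0) weight R t c <= 713%:R / 1000%:R by [].
elim: d => [|d [Sd Bd]].
  by rewrite /= !big_cons !big_nil /weight /= !expr0; split; lra.
have SB := ler_pM (S_ge0 d) (B_ge0 d) Sd Bd.
have := total_weight_step R t t_ge0 d.
have := origin_weight_step R t t_ge0 d.
by rewrite /t; split; lra.
Qed.

(** * From weights to the bound on [Rnum] *)

(** The guards on x and y exclude the values that [inord] would send to its default 0. *)
Lemma calR_tri_closed n (Y : {set 'I_n.+1 * 'I_n.+1}) : Y \in calR n ->
  tri_closed n.+1 (fun x y => [&& x <= n, y <= n & (inord x, inord y) \in Y])%N.
Proof.
rewrite inE => /andP[/subsetP subQ /forall_inP clY]; split.
  move=> x y /and3P[le_x le_y /subQ]; rewrite inE /= !inordK //.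
move=> x y x' y' /and3P[le_x le_y Yp] /and3P[le_x' le_y' Yq] le_n.
have inord_min a b : (a <= n)%N -> (b <= n)%N ->
    Order.min (inord a) (inord b) = inord (minn a b) :> 'I_n.+1.
  move=> le_a le_b; rewrite minEle /minn leEord /= !inordK //.
  by case: ltngtP => // ->.
have inord_max a b : (a <= n)%N -> (b <= n)%N ->
    Order.max (inord a) (inord b) = inord (maxn a b) :> 'I_n.+1.
  move=> le_a le_b; rewrite maxEle /maxn leEord /= !inordK //.
  by case: ltngtP => // ->.
have le_mx : (maxn x x' <= n)%N by lia.
have le_my : (maxn y y' <= n)%N by lia.
have /forall_inP/(_ _ Yq) := clY _ Yp.
rewrite /pmax /pmin /= !inord_min // !inord_max // !inordK // le_n /=.
case/andP=> min_in /implyP max_in; rewrite min_in le_mx le_my; split.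
  by rewrite andbT; apply/andP; split; lia.
by move=> lt_n; apply: max_in; rewrite inE /= !inordK.
Qed.

(** A code of dimension n + 1 weighs at least t ^ (n + 1), since [2 ^ col0] is at least 1; so the
    total weight bounds the number of such codes. *)
Lemma Rnum_le (R : realFieldType) n :
  (Rnum n)%:R <= 93%:R / 50%:R * (127%:R / 10%:R) ^+ n.+1 :> R.
Proof.
pose t : R := 10%:R / 127%:R.
have t_gt0 : 0 < t by rewrite /t; lra.
pose img c := [set p : 'I_n.+1 * 'I_n.+1 | pts c p.1 p.2].
pose cs := [seq c <- codes n.+1 | dim c == n.+1].
have le_size : (Rnum n <= size cs)%N.
  rewrite -(size_map img) /Rnum; apply: leq_trans (card_size _).
  apply: subset_leq_card; apply/subsetP => Y /calR_tri_closed.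
  case/(codes_complete n.+1 _ _ (leqnn _)) => c cin [dc _ pc].
  apply/mapP; exists c; first by rewrite mem_filter dc eqxx.
  apply/setP => -[i j]; rewrite inE pc /= !leq_ord /=.
  by rewrite !inord_val.
have : (size cs)%:R * t ^+ n.+1 <= 93%:R / 50%:R.
  apply: le_trans (total_weight_le R n.+1).
  rewrite -sum1_size natr_sum mulr_suml big_filter big_mkcond.
  apply: ler_sum => c _; case: eqP => [<-|_]; last exact/weight_ge0/ltW.
  by rewrite ler_wpM2r ?exprn_ge0 ?(ltW t_gt0) // exprn_ege1 // ler1n.
rewrite -ler_pdivlMr ?exprn_gt0 // -exprVn /t invf_div.
by apply: le_trans; rewrite ler_nat.
Qed.

Lemma bernoulli_le (R : realFieldType) (x : R) n :
  0 <= x -> 1 + n%:R * x <= (1 + x) ^+ n.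
Proof.
move=> x_ge0; elim: n => [|n IH]; first by rewrite mul0r addr0.
rewrite exprS; apply: le_trans (ler_wpM2l _ IH); last by lra.
have : 0 <= n%:R * x * x by rewrite !mulr_ge0.
by rewrite -natr1; lra.
Qed.

Theorem theorem20 (R : realType) (eps : R) (eps_gt0 : 0 < eps) :
  exists N : nat, forall n : nat, (N <= n)%N ->
    (Rnum n)%:R < (7%:R + Num.sqrt 33%:R + eps) ^+ n :> R.
Proof.
(* By Bernoulli, (1 + 1/318) ^ n is at least 1 + 7500/318 > 24, which absorbs the factor 93/50 *
   127/10 < 24. The threshold is uniform in [eps]. *)
exists (75 * 100)%N => n le_n.
have sqrt33 : 574%:R / 100%:R <= Num.sqrt 33%:R :> R.
  by rewrite -[leLHS]ger0_norm -?sqrtr_sqr ?ler_wsqrtr //; lra.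
apply: le_lt_trans (Rnum_le R n) _.
(* The ratio 1 + 1/318 fits between 12.7 and 7 + 5.74 = 12.74. *)
have le_base : (127%:R / 10%:R) * (1 + 1 / 318%:R) <= 7%:R + Num.sqrt 33%:R + eps by lra.
apply: lt_le_trans (lerXn2r n _ _ le_base); rewrite ?nnegrE; try lra.
rewrite [ltRHS]exprMn exprS mulrA mulrC ltr_pM2l ?exprn_gt0 //; try lra.
apply: lt_le_trans (bernoulli_le R _ n _); last by lra.
have : (75 * 100)%:R <= n%:R :> R by rewrite ler_nat.
by rewrite natrM; lra.
Qed.
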